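(* Let $L$ and $M$ be completely distributive lattices with $\bot_L\ne\top_L$ and $\beta(a\wedge b)=\beta(a)\cap\beta(b)$ for all $a,b\in L$. Let $(X,\mathscr{C})$ and $(Y,\mathscr{D})$ be two $M$-fuzzifying convex structures and let $f:X\to Y$ be a function. Then $f:(X,\mathscr{C})\to(Y,\mathscr{D})$ is an $M$-fuzzifying convexity preserving function if and only if $f:(X,\omega(\mathscr{C}))\to(Y,\omega(\mathscr{D}))$ is an $(L,M)$-fuzzy convexity preserving function.
   Context: For $a,b\in L$, $a\prec b$ means that for every subset $D\subseteq L$ with $b\le\sup D$ there is $d\in D$ with $a\le d$; $\beta(b)=\{a\in L: a\prec b\}$. $X,Y$ are nonempty sets; $L^X$ is the set of all functions $X\to L$ with the pointwise order, with least element $\chi_\emptyset$ and greatest element $\chi_X$. For $A\in L^X$ and $a\in L$, $A_{[a]}=\{x\in X: a\le A(x)\}$. For $B\in L^Y$, $f_L^{\leftarrow}(B)=B\circ f\in L^X$. An $M$-fuzzifying convexity on $X$ is a map $\mathscr{C}:\mathbf{2}^X\to M$ ($\mathbf{2}^X$ the power set) with: (1) $\mathscr{C}(\emptyset)=\mathscr{C}(X)=\top_M$; (2) $\mathscr{C}(\bigcap_{i}A_i)\ge\bigwedge_i\mathscr{C}(A_i)$ for every nonempty family of subsets of $X$; (3) $\mathscr{C}(\bigcup_i A_i)\ge\bigwedge_i\mathscr{C}(A_i)$ for every nonempty family of subsets totally ordered by inclusion. Then $(X,\mathscr{C})$ is an $M$-fuzzifying convex structure. A function $f:(X,\mathscr{C})\to(Y,\mathscr{D})$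 is $M$-fuzzifying convexity preserving if $\mathscr{C}(f^{-1}(B))\ge\mathscr{D}(B)$ for all $B\subseteq Y$. An $(L,M)$-fuzzy convexity on $X$ is a map $\mathcal{C}:L^X\to M$ with: (LMC1) $\mathcal{C}(\chi_\emptyset)=\mathcal{C}(\chi_X)=\top_M$; (LMC2) $\mathcal{C}(\bigwedge_i A_i)\ge\bigwedge_i\mathcal{C}(A_i)$ for every nonempty family in $L^X$; (LMC3) $\mathcal{C}(\bigvee_i A_i)\ge\bigwedge_i\mathcal{C}(A_i)$ for every nonempty family in $L^X$ totally ordered by $\le$. A function $f:(X,\mathcal{C})\to(Y,\mathcal{D})$ between sets with $(L,M)$-fuzzy convexities is $(L,M)$-fuzzy convexity preserving if $\mathcal{C}(f_L^{\leftarrow}(B))\ge\mathcal{D}(B)$ for all $B\in L^Y$. For an $M$-fuzzifying convexity $\mathscr{C}$ on $X$, $\omega(\mathscr{C})$ is the $(L,M)$-fuzzy convexity on $X$ given by $\omega(\mathscr{C})(A)=\bigwedge_{a\in L}\mathscr{C}(A_{[a]})$ for $A\in L^X$ (and similarly on $Y$). *)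

(* Defs.v *)
From HB Require Import structures.
From mathcomp Require Import all_boot all_order.
From mathcomp Require Import boolp classical_sets.

Set Implicit Arguments.
Unset Strict Implicit.
Unset Printing Implicit Defensive.

Import Order.TTheory.
Local Open Scope order_scope.
Local Open Scope classical_set_scope.

HB.mixin Record TBLattice_isComplete (d : Order.disp_t) (T : Type)
    of Order.TBLattice d T := {
  csup : set T -> T ;
  cinf : set T -> T ;
  csup_supremums : forall A : set T, supremums A (csup A) ;
  cinf_infimums : forall A : set T, infimums A (cinf A) }.

#[short(type="completeLatticeType")]
HB.structure Definition CompleteLattice d :=
  { T of TBLattice_isComplete d T & Order.TBLattice d T }.

(* The law  /\_i \/_(j : J i) a i j = \/_g /\_i a i (g i),  where g ranges over
   the choice functions of the family J. *)
HB.mixin Record CompleteLattice_isCompletelyDistributive (d : Order.disp_t)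
    (T : Type) of CompleteLattice d T := {
  cinf_csup : forall (I : Type) (J : I -> Type) (a : forall i, J i -> T),
    cinf (range (fun i => csup (range (a i)))) =
    csup (range (fun g : forall i, J i => cinf (range (fun i => a i (g i))))) }.

#[short(type="cdLatticeType")]
HB.structure Definition CDLattice d :=
  { T of CompleteLattice_isCompletelyDistributive d T & CompleteLattice d T }.

Section CompleteLatticeTheory.
Context {d : Order.disp_t} {L : completeLatticeType d}.
Implicit Types (A B : set L) (a b : L).

Lemma csup_ub A a : A a -> a <= csup A.
Proof. by case: (csup_supremums A) => + _; exact. Qed.

Lemma csup_least A b : (forall a, A a -> a <= b) -> csup A <= b.
Proof. by case: (csup_supremums A) => _; exact. Qed.

Lemma cinf_lb A a : A a -> cinf A <= a.
Proof. by case: (cinf_infimums A) => + _; exact. Qed.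

Lemma cinf_greatest A b : (forall a, A a -> b <= a) -> b <= cinf A.
Proof. by case: (cinf_infimums A) => _; exact. Qed.

Definition prec a b : Prop :=
  forall D : set L, b <= csup D -> exists2 d, D d & a <= d.

Definition beta b : set L := [set a | prec a b].

End CompleteLatticeTheory.

Lemma le_csup_beta (d : Order.disp_t) (L : cdLatticeType d) (a : L) :
  a <= csup (beta a).
Proof.
pose I := {D : set L | a <= csup D}.
pose J (i : I) := {x : L | sval i x}.
have := cinf_csup I J (fun i (j : J i) => sval j).
set l := cinf _; set r := csup _ => lr.
have al : a <= l.
  apply: cinf_greatest => _ [[D aD] _ <-].
  rewrite (le_trans aD)//; apply: csup_least => x Dx; apply: csup_ub.
  by exists (exist _ x Dx).
rewrite (le_trans al)// lr; apply: csup_least => _ [g _ <-].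
apply: csup_ub => D aD; pose i : I := exist _ D aD.
exists (sval (g i)); first exact: (svalP (g i)).
by apply: cinf_lb; exists i.
Qed.

Section Convexity.
Context {dM : Order.disp_t} {M : completeLatticeType dM}.

Record fuzzifyingConvexity (X : Type) := FuzzifyingConvexity {
  fuzzifying_fun :> set X -> M ;
  fuzzifying0 : fuzzifying_fun set0 = \top ;
  fuzzifyingT : fuzzifying_fun setT = \top ;
  fuzzifying_bigcap : forall F : set (set X), F !=set0 ->
    cinf (fuzzifying_fun @` F) <= fuzzifying_fun (\bigcap_(A in F) A) ;
  fuzzifying_bigcup : forall F : set (set X), F !=set0 ->
    total_on F (fun A B => A `<=` B) ->
    cinf (fuzzifying_fun @` F) <= fuzzifying_fun (\bigcup_(A in F) A) }.

Definition fuzzifying_preserving (X Y : Type) (C : fuzzifyingConvexity X)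
    (D : fuzzifyingConvexity Y) (f : X -> Y) : Prop :=
  forall B : set Y, D B <= C (f @^-1` B).

(* [X -> L] carries the pointwise order of [boolp]. *)
Context {dL : Order.disp_t} {L : completeLatticeType dL}.

Record fuzzyConvexity (X : Type) := FuzzyConvexity {
  fuzzy_fun :> (X -> L) -> M ;
  fuzzy_bot : fuzzy_fun (fun=> \bot) = \top ;
  fuzzy_top : fuzzy_fun (fun=> \top) = \top ;
  fuzzy_inf : forall F : set (X -> L), F !=set0 ->
    cinf (fuzzy_fun @` F) <=
    fuzzy_fun (fun x => cinf [set A x | A in F]) ;
  fuzzy_sup : forall F : set (X -> L), F !=set0 ->
    total_on F (fun A B => A <= B) ->
    cinf (fuzzy_fun @` F) <=
    fuzzy_fun (fun x => csup [set A x | A in F]) }.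

Definition fuzzy_preserving (X Y : Type) (C : fuzzyConvexity X)
    (D : fuzzyConvexity Y) (f : X -> Y) : Prop :=
  forall B : Y -> L, D B <= C (B \o f).

Definition cut (X : Type) (A : X -> L) (a : L) : set X := [set x | a <= A x].

Definition omega_fun (X : Type) (C : fuzzifyingConvexity X) (A : X -> L) : M :=
  cinf (range (fun a : L => C (cut A a))).

End Convexity.

Arguments fuzzifyingConvexity {dM} M X.
Arguments fuzzyConvexity {dM} M {dL} L X.

Section Omega.
Context {dM : Order.disp_t} {M : completeLatticeType dM}.
Context {dL : Order.disp_t} (L : cdLatticeType dL).
Context {X : Type} (C : fuzzifyingConvexity M X).

Let omegaC : (X -> L) -> M := omega_fun C.

Lemma omega_bot : omegaC (fun=> \bot) = \top.
Proof.
apply/eqP; rewrite -le1x; apply: cinf_greatest => _ [a _ <-].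
have [a0|a0] := pselect (a <= \bot).
  by rewrite (_ : cut _ a = setT) ?fuzzifyingT// -subTset => x _.
by rewrite (_ : cut _ a = set0) ?fuzzifying0// -subset0 => x.
Qed.

Lemma omega_top : omegaC (fun=> \top) = \top.
Proof.
apply/eqP; rewrite -le1x; apply: cinf_greatest => _ [a _ <-].
rewrite (_ : cut _ a = setT) ?fuzzifyingT// -subTset => x _.
exact: lex1.
Qed.

Lemma omega_inf (F : set (X -> L)) : F !=set0 ->
  cinf (omegaC @` F) <= omegaC (fun x => cinf [set A x | A in F]).
Proof.
move=> [A0 FA0]; apply: cinf_greatest => _ [a _ <-].
pose G := [set cut A a | A in F].
rewrite (_ : cut _ a = \bigcap_(B in G) B); last first.
  apply/seteqP; split=> x.
    by move=> ax _ [A FA <-]; apply: (le_trans ax); apply: cinf_lb; exists A.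
  by move=> Gx; apply: cinf_greatest => _ [A FA <-]; apply: (Gx (cut A a)); exists A.
apply: le_trans (fuzzifying_bigcap C _); last by exists (cut A0 a); exists A0.
apply: cinf_greatest => _ [_ [A FA <-] <-].
apply: (@le_trans _ _ (omegaC A)); apply: cinf_lb; [by exists A|by exists a].
Qed.

Lemma omega_sup (F : set (X -> L)) : F !=set0 ->
  total_on F (fun A B => A <= B) ->
  cinf (omegaC @` F) <= omegaC (fun x => csup [set A x | A in F]).
Proof.
move=> [A0 FA0] Ftot; apply: cinf_greatest => _ [a _ <-].
pose U b := \bigcup_(B in [set cut A b | A in F]) B.
pose G := U @` beta a.
have [[b0 ab0]|ba0] := pselect (beta a !=set0); last first.
  rewrite (_ : cut _ a = setT) ?fuzzifyingT ?lex1// -subTset => x _.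
  rewrite /cut/= (le_trans (le_csup_beta a))//; apply: csup_least => b ab.
  by case: ba0; exists b.
rewrite (_ : cut _ a = \bigcap_(B in G) B); last first.
  apply/seteqP; split=> x.
    move=> ax _ [b ab <-]; have [_ [A FA <-] bAx] := ab _ ax.
    by exists (cut A b) => //; exists A.
  move=> Gx; rewrite /cut/= (le_trans (le_csup_beta a))//.
  apply: csup_least => b ab.
  have [|_ [A FA <-] bAx] := Gx (U b); first by exists b.
  by apply: (le_trans bAx); apply: csup_ub; exists A.
apply: le_trans (fuzzifying_bigcap C _); last by exists (U b0); exists b0.
apply: cinf_greatest => _ [_ [b ab <-] <-].
apply: le_trans (fuzzifying_bigcup C _ _); last 2 first.
- by exists (cut A0 b); exists A0.
- move=> _ _ [A FA <-] [B FB <-].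
  by have [/lefP AB|/lefP BA] := Ftot _ _ FA FB; [left|right] => x /= bx;
    rewrite /cut/= (le_trans bx).
apply: cinf_greatest => _ [_ [A FA <-] <-].
apply: (@le_trans _ _ (omegaC A)); apply: cinf_lb; [by exists A|by exists b].
Qed.

Definition omega : fuzzyConvexity M L X :=
  FuzzyConvexity omega_bot omega_top omega_inf omega_sup.

End Omega.

(* Main.v *)
Require Import Defs.
From mathcomp Require Import all_boot all_order.
From mathcomp Require Import boolp classical_sets.

(** Cuts commute with preimages: the cut of [B \o f] at [a] is the preimage
    under [f] of the cut of [B] at [a].  Crisp preservation, applied to each cut
    of [B], therefore bounds the infimum defining [omega] term by term.

    Conversely, every subset [B] of [Y] is recovered from its [L]-valued
    indicator: the cuts of the indicator are [B] and the whole space, and the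
    latter has the greatest possible degree of convexity, so [omega] restricts to
    the original convexity along indicators ([omega_fun_indicator]).  Since the
    indicator of [f @^-1` B] is the indicator of [B] composed with [f], fuzzy
    preservation at indicators is exactly crisp preservation. *)

Import Order.TTheory.
Local Open Scope order_scope.
Local Open Scope classical_set_scope.

Section Indicator.
Context {dL : Order.disp_t} (L : completeLatticeType dL).

Definition indicator {X : Type} (B : set X) (x : X) : L :=
  if `[< B x >] then \top else \bot.

Lemma cut_indicator_bot {X : Type} (B : set X) (a : L) :
  a <= \bot -> cut (indicator B) a = setT.
Proof.
by move=> a0; rewrite -subTset => x _; apply: (le_trans a0); exact: le0x.
Qed.

Lemma cut_indicator {X : Type} (B : set X) (a : L) :
  ~ a <= \bot -> cut (indicator B) a = B.
Proof.
move=> a0; apply/seteqP; split=> x; rewrite /cut /indicator /=.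
  by case: asboolP.
by move=> /asboolT ->; exact: lex1.
Qed.

(** Nontriviality of [L] guarantees that the cut at [\top] is [B]; in a trivial
    lattice all cuts are the whole space. *)
Lemma omega_fun_indicator {dM : Order.disp_t} {M : completeLatticeType dM}
    {X : Type} (C : fuzzifyingConvexity M X) (B : set X) :
  (\bot : L) <> \top -> omega_fun C (indicator B) = C B.
Proof.
move=> L01; apply: le_anti; apply/andP; split.
  apply: cinf_lb; exists \top => //.
  by rewrite cut_indicator// lex0 => /eqP /esym.
apply: cinf_greatest => _ [a _ <-].
have [/cut_indicator_bot ->|/cut_indicator ->//] := pselect (a <= \bot).
by rewrite fuzzifyingT; exact: lex1.
Qed.

End Indicator.

Theorem theorem6p3 (dL dM : Order.disp_t)
  (L : cdLatticeType dL) (M : cdLatticeType dM)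
  (L_nontrivial : (\bot : L)%O <> (\top : L)%O)
  (beta_meet : forall a b : L, beta (a `&` b)%O = beta a `&` beta b)
  (X Y : Type) (X_nonempty : [set: X] !=set0) (Y_nonempty : [set: Y] !=set0)
  (C : fuzzifyingConvexity M X) (D : fuzzifyingConvexity M Y) (f : X -> Y) :
  fuzzifying_preserving C D f <->
  fuzzy_preserving (omega L C) (omega L D) f.
Proof.
split=> [Cf B|Cf B].
  apply: cinf_greatest => _ [a _ <-].
  (* [cut (B \o f) a] is convertible to [f @^-1` cut B a] *)
  apply: le_trans (Cf (cut B a)).
  by apply: cinf_lb; exists a.
have := Cf (indicator L B).
change (omega_fun D (indicator L B) <=
        omega_fun C (indicator L (f @^-1` B)) -> D B <= C (f @^-1` B)).
by rewrite !omega_fun_indicator.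
Qed.
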